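(* Let $\ell\in\mathbb{N}$, let $G$ be a connected graph of order $m\in\{\ell,\ell+1,\ell+2\}$, and let $n_1,\dots,n_\ell\in\mathbb{N}$. Then $q\big(G\vee \bigcup_{j=1}^\ell K_{n_j}\big)=2$.
   Context: Graphs are finite, simple, with nonempty vertex sets; $K_n$ is the complete graph on $n$ vertices and $\bigcup$ denotes disjoint union. $G\vee H$ is the join. $S(G)$ is the set of real symmetric matrices whose off-diagonal nonzero pattern is the edge set of $G$ (diagonal free), and $q(G)$ is the minimum number of distinct eigenvalues of a matrix in $S(G)$. *)

(* Defs.v *)
From HB Require Import structures.
From mathcomp Require Import all_boot all_order all_algebra.
From mathcomp Require Import finmap.
From mathcomp Require Import boolp classical_sets cardinality reals.

Set Implicit Arguments.
Unset Strict Implicit.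
Unset Printing Implicit Defensive.

Import Order.TTheory GRing.Theory Num.Theory.

Local Open Scope ring_scope.

Record sgraph := SGraph {
  svertex :> finType;
  sedge : rel svertex;
  sedge_sym : symmetric sedge;
  sedge_irr : irreflexive sedge }.

Definition connected (G : sgraph) : Prop :=
  forall x y : G, connect (@sedge G) x y.

Section Complete.
Variable n : nat.

Definition complete_edge : rel 'I_n := fun x y => x != y.

Lemma complete_edge_sym : symmetric complete_edge.
Proof. by move=> x y; rewrite /complete_edge eq_sym. Qed.

Lemma complete_edge_irr : irreflexive complete_edge.
Proof. by move=> x; rewrite /complete_edge eqxx. Qed.

Definition complete := SGraph complete_edge_sym complete_edge_irr.
End Complete.

Section DisjointUnion.
Variables (I : finType) (H : I -> sgraph).

(* [tagged_as u v] is the second component of [v], cast to the type of that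
   of [u]; the cast is only used when the two tags agree. *)
Definition disjoint_union_edge : rel {i : I & svertex (H i)} :=
  fun u v => (tag u == tag v) && sedge (tagged u) (tagged_as u v).

Lemma disjoint_union_edge_sym : symmetric disjoint_union_edge.
Proof.
move=> [i x] [j y]; rewrite /disjoint_union_edge /=.
case: (eqVneq i j) => //= eij; case: _ / eij y => y.
by rewrite !tagged_asE sedge_sym.
Qed.

Lemma disjoint_union_edge_irr : irreflexive disjoint_union_edge.
Proof.
by move=> [i x]; rewrite /disjoint_union_edge /= eqxx tagged_asE sedge_irr.
Qed.

Definition disjoint_union :=
  SGraph disjoint_union_edge_sym disjoint_union_edge_irr.
End DisjointUnion.

Section Join.
Variables G H : sgraph.

Definition join_edge : rel (G + H)%type := fun u v =>
  match u, v with
  | inl x, inl y => sedge x y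
  | inr x, inr y => sedge x y
  | _, _ => true
  end.

Lemma join_edge_sym : symmetric join_edge.
Proof. by move=> [x|x] [y|y] //=; rewrite sedge_sym. Qed.

Lemma join_edge_irr : irreflexive join_edge.
Proof. by move=> [x|x] /=; rewrite sedge_irr. Qed.

Definition join := SGraph join_edge_sym join_edge_irr.
End Join.

Section Q.
Variable R : realType.

(* Rows and columns are indexed by the vertices through [enum_val]. *)
Definition Smx (G : sgraph) : set 'M[R]_#|G| :=
  [set A : 'M[R]_#|G| | A^T = A /\
    forall i j, i != j -> (A i j != 0) = sedge (enum_val i) (enum_val j)].

(* [fset_set] is the empty set on infinite sets; [finite_spectrum] shows that
   this never happens here. *)
Definition num_eigenvalues (n : nat) (A : 'M[R]_n) : nat :=
  #|` fset_set [set a : R | eigenvalue A a] |.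

Lemma finite_spectrum (n : nat) (A : 'M[R]_n) :
  finite_set [set a : R | eigenvalue A a].
Proof.
have cA0 : char_poly A != 0 by exact/monic_neq0/char_poly_monic.
apply: contrapT => /(@infinite_set_fset _ _ (size (char_poly A))) [B BA].
rewrite leqNgt => /negP; apply; apply: max_poly_roots (fset_uniq B) => //.
by apply/allP => a /BA /=; rewrite eigenvalue_root_char.
Qed.

Definition attained (G : sgraph) (k : nat) : Prop :=
  exists2 A : 'M[R]_#|G|, Smx A & num_eigenvalues A = k.

Lemma ex_attained (G : sgraph) : exists k, `[< attained G k >].
Proof.
pose A : 'M[R]_#|G| := \matrix_(i, j) (sedge (enum_val i) (enum_val j))%:R.
exists (num_eigenvalues A); apply/asboolP; exists A => //; split.
  by apply/matrixP => i j; rewrite !mxE sedge_sym.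
by move=> i j _; rewrite mxE pnatr_eq0; case: sedge.
Qed.

Definition q (G : sgraph) : nat := ex_minn (ex_attained G).

End Q.

(* Main.v *)
(* Write the matrix sought as an orthogonal projection P = U U^T, whose only
   eigenvalues are 0 and 1. Let M be a matrix of S(G) with spectral decomposition
   V^T diag(mu) V, where all mu_j lie in [0, 1], exactly l of them (those with
   j = f c, c < l) lie in ]0, 1[, and V has no zero entry. Row x of U, for a
   vertex x of G, is (sqrt(mu_j) V_jx)_j, and every row of the c-th clique is
   sqrt((1 - mu_(f c)) / n_c) times the basis vector of index f c. The Gram matrix
   U^T U is then diagonal with 0/1 entries, so P is a projection, and its pattern
   is that of the join.

   Such an M is an affine image of any matrix of S(G) with simple spectrum and
   nowhere zero eigenvectors: when G has l + 1 (resp. l + 2) vertices, the smallest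
   eigenvalue is sent to 0 (resp. and the largest one to 1).

   A symmetric matrix A has simple spectrum and nowhere zero eigenvectors as soon
   as every basis vector e_i is cyclic for A, i.e. its Krylov determinant
   det [e_i, A e_i, A^2 e_i, ...] does not vanish. These determinants are
   polynomials in the entries of A, so it suffices to make each of them nonzero
   separately, by a matrix supported on the edges of G. For a given root this is
   achieved by a matrix which is triangular for the distance to the root, followed
   by a perturbation that is conjugate to a symmetric matrix. *)
Require Import Defs.
From mathcomp Require Import all_boot all_order all_algebra.
From mathcomp Require Import finmap complex spectral ring lra.
From mathcomp Require Import boolp classical_sets cardinality reals.

Set Implicit Arguments.
Unset Strict Implicit.
Unset Printing Implicit Defensive.

Import Order.TTheory GRing.Theory Num.Theory.

Local Open Scope ring_scope.

(** * Krylov matrices and entries of eigenvectors *)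

Definition krylov (R : pzRingType) m (A : 'M[R]_m) (i : 'I_m) : 'M[R]_m :=
  \matrix_(j, k) (A ^+ k) j i.

Lemma map_krylov (R S : pzRingType) (f : {rmorphism R -> S}) m (A : 'M[R]_m) i :
  map_mx f (krylov A i) = krylov (map_mx f A) i.
Proof. by apply/matrixP => j k; rewrite !mxE -rmorphXn mxE. Qed.

Lemma mulmx_intertwineX (R : comPzRingType) m (Y A B : 'M[R]_m) k :
  Y *m A = B *m Y -> Y *m A ^+ k = B ^+ k *m Y.
Proof.
move=> YA; elim: k => [|k IHk]; first by rewrite !expr0 mulmx1 mul1mx.
by rewrite !exprSr -!mulmxE mulmxA IHk -!mulmxA YA.
Qed.

Lemma diag_mxX (R : comPzRingType) m (x : 'rV[R]_m) k :
  diag_mx x ^+ k = diag_mx (map_mx (fun a => a ^+ k) x).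
Proof.
elim: k => [|k IHk].
  by apply/matrixP => i j; rewrite expr0 !mxE.
by rewrite exprS IHk -mulmxE mulmx_diag; congr diag_mx; apply/rowP => j;
  rewrite !mxE exprS.
Qed.

(* The product of [Y] with the Krylov matrix is a diagonal times a Vandermonde
   matrix. *)
Lemma det_krylov_neq0 (F : fieldType) m (B Y : 'M[F]_m) (x : 'rV[F]_m) i :
  Y *m B = diag_mx x *m Y -> injective (x 0) -> (forall v, Y v i != 0) ->
  \det (krylov B i) != 0.
Proof.
move=> YB xI Yi.
have YK : Y *m krylov B i = diag_mx (\row_v Y v i) *m (Vandermonde m x)^T.
  apply/matrixP => v k; rewrite mul_diag_mx !mxE.
  have := congr1 (fun M : 'M_m => M v i) (mulmx_intertwineX k YB).
  rewrite /= diag_mxX mul_diag_mx !mxE mulrC => <-.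
  by apply: eq_bigr => j _; rewrite !mxE.
have : \det (Y *m krylov B i) != 0.
  rewrite YK det_mulmx det_diag det_tr det_Vandermonde mulf_neq0 //.
    by apply/prodf_neq0 => v _; rewrite mxE.
  apply/prodf_neq0 => j _; apply/prodf_neq0 => k jk.
  by rewrite subr_eq0 (inj_eq xI); apply: contraTneq jk => ->; rewrite ltnn.
by rewrite det_mulmx mulf_eq0 negb_or => /andP[].
Qed.

(** If [y] vanished at [i], every [y *m A ^+ k] would too, so [y] would annihilate the invertible
    Krylov matrix of [i]. *)
Lemma eigenvector_entry_neq0 (F : fieldType) m (A : 'M[F]_m) (y : 'rV[F]_m) a i :
  \det (krylov A i) != 0 -> y *m A = a *: y -> y != 0 -> y 0 i != 0.
Proof.
move=> Ki yA; apply: contraNneq => yi.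
have yX k : y *m A ^+ k = a ^+ k *: y.
  elim: k => [|k IHk]; first by rewrite !expr0 mulmx1 scale1r.
  by rewrite exprS -mulmxE mulmxA yA -scalemxAl IHk scalerA exprS.
have Ku : krylov A i \in unitmx by rewrite unitmxE unitfE.
rewrite -[y](mulmxK Ku); suff -> : y *m krylov A i = 0 by rewrite mul0mx.
apply/rowP => k; have := congr1 (fun v : 'rV_m => v 0 i) (yX k).
rewrite !mxE yi mulr0 => yk0; rewrite -[RHS]yk0.
by apply: eq_bigr => j _; rewrite mxE.
Qed.

(** * Generic points *)

(** Only the line through two points is ever considered, so univariate polynomials suffice. *)
Definition poly_on_lines (R : comNzRingType) (V : lmodType R) (f : V -> R) :=
  forall u v, exists p : {poly R}, forall t, f (u + t *: v) = p.[t].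

Lemma poly_nonroot (F : numDomainType) (p : {poly F}) :
  p != 0 -> exists t, p.[t] != 0.
Proof.
move=> p0; pose s : seq F := [seq i%:R | i <- iota 0 (size p)].
have: ~~ all (root p) s.
  apply/negP => /(max_poly_roots p0); rewrite size_map size_iota ltnn.
  by rewrite (map_inj_uniq (mulrIn (oner_neq0 F))) iota_uniq => /(_ isT).
by move=> /allPn[t _]; exists t.
Qed.

(** Induction on the list of conditions: join a point good for the earlier ones to a witness of the
    new one. Every condition restricts to a nonzero polynomial on that line, and so does their
    product. *)
Lemma generic_point (F : numDomainType) (V : lmodType F) (I : finType)
    (W : V -> Prop) (f : I -> V -> F) (w0 : V) :
  W w0 -> (forall u v t, W u -> W v -> W (u + t *: (v - u))) ->
  (forall i, poly_on_lines (f i)) -> (forall i, exists2 w, W w & f i w != 0) ->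
  exists2 w, W w & forall i, f i w != 0.
Proof.
move=> Ww0 Wline fP fW.
suff [w Ww ws] : exists2 w, W w & forall i, i \in enum I -> f i w != 0.
  by exists w => // i; apply: ws; rewrite mem_enum.
elim: (enum I) => [|i s [u Wu us]]; first by exists w0.
have [v Wv fv] := fW i.
have pP j : {p : {poly F} | forall t, f j (u + t *: (v - u)) = p.[t]}.
  exact/cid/fP.
pose P j := sval (pP j); have PE j t : f j (u + t *: (v - u)) = (P j).[t].
  by rewrite /P; case: (pP j).
have [t] : exists t, (\prod_(j <- i :: s) P j).[t] != 0.
  apply: poly_nonroot; rewrite prodf_seq_neq0; apply/allP => j.
  rewrite inE => /orP[/eqP->|js]; apply/implyP => _.
    apply: contraNneq fv => P0.
    by rewrite -[v](subrKC u) -[v - u]scale1r PE P0 horner0.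
  apply: contraNneq (us _ js) => P0.
  by rewrite -[u]addr0 -(scale0r (v - u)) PE P0 horner0.
rewrite horner_prod prodf_seq_neq0 => /allP Pt.
by exists (u + t *: (v - u)); [exact: Wline | move=> j /Pt; rewrite PE].
Qed.

Lemma det_krylov_poly_on_lines (R : comNzRingType) m (i : 'I_m) :
  poly_on_lines (fun A : 'M[R]_m => \det (krylov A i)).
Proof.
move=> A B; exists (\det (krylov (map_mx polyC A + 'X *: map_mx polyC B) i)) => t.
rewrite -horner_evalE -det_map_mx map_krylov; congr (\det (krylov _ i)).
by apply/matrixP => j k; rewrite !mxE rmorphD rmorphM /= /horner_eval !hornerC hornerX.
Qed.

Lemma entry_poly_on_lines (R : comNzRingType) m n (i : 'I_m) (j : 'I_n) :
  poly_on_lines (fun A : 'M[R]_(m, n) => A i j).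
Proof.
by move=> A B; exists ((A i j)%:P + B i j *: 'X) => t;
  rewrite !mxE hornerD hornerC hornerZ hornerX mulrC.
Qed.

(** * Distance layers and a matrix cyclic at a given root *)

(** [d] is the length of a shortest path from [r]; the parent of [x] is the vertex before [x] on
    such a path. *)
Lemma distance_layers (T : finType) (e : rel T) (r : T) :
  (forall x, connect e r x) ->
  exists d : T -> nat, [/\ d r = 0%N, forall x, d x = 0%N -> x = r &
    forall x n, d x = n.+1 -> exists2 y, e y x & d y = n].
Proof.
move=> conn.
pose P x n := [exists p : n.-tuple T, path e r p && (last r p == x)].
have PI x p : path e r p -> last r p = x -> P x (size p).
  by move=> ep lp; apply/existsP; exists (in_tuple p); rewrite ep lp eqxx.
have exP x : exists n, P x n.
  by have /connectP[p ep ->] := conn x; exists (size p); exact: PI.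
pose d x := ex_minn (exP x).
have dP x : P x (d x) by rewrite /d; case: ex_minnP.
have d_min x n : P x n -> (d x <= n)%N by rewrite /d; case: ex_minnP => k _; apply.
exists d; split.
- by apply/eqP; rewrite -leqn0; apply: d_min; exact: (PI _ [::]).
- move=> x dx; have := dP x; rewrite dx => /existsP[p].
  by rewrite tuple0 => /andP[_ /eqP].
- move=> x n dx; have := dP x; rewrite dx => /existsP[[p /= /eqP sp]].
  case/lastP: p sp => // p y; rewrite size_rcons => -[sp].
  rewrite rcons_path last_rcons => /andP[/andP[ep ey] /eqP yx].
  rewrite {}yx in ey; exists (last r p) => //; apply/eqP; rewrite eqn_leq.
  have -> /= : (d (last r p) <= n)%N by rewrite -sp; apply: d_min; exact: PI.
  rewrite -ltnS -dx; have /existsP[w /andP[ew /eqP lw]] := dP (last r p).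
  have -> : (d (last r p)).+1 = size (rcons w x) by rewrite size_rcons size_tuple.
  by apply/d_min/PI; rewrite ?last_rcons // rcons_path ew lw.
Qed.

Section LayeredWitness.
Variables (F : rcfType) (m : nat) (e : rel 'I_m) (d : 'I_m -> nat) (r : 'I_m).
Hypotheses (e_sym : symmetric e) (d_r : d r = 0%N).
Hypothesis d0 : forall x, d x = 0%N -> x = r.
Hypothesis d_parent : forall x n, d x = n.+1 -> exists2 y, e y x & d y = n.

Let arc (c w : 'I_m) := e w c && (d c == (d w).+1).
(** With [d w] as leading digit in base [m], the weights are distinct and increase with the
    distance. *)
Let weight (w : 'I_m) : F := (d w * m + w)%:R.

Let weight_inj : injective weight.
Proof.
move=> v w /eqP; rewrite eqr_nat => /eqP vw; apply: val_inj.
by have := congr1 (modn^~ m) vw; rewrite !modnMDl !modn_small.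
Qed.

Let weight_lt v w : (d v < d w)%N -> weight v < weight w.
Proof.
move=> vw; rewrite ltr_nat; apply: (@leq_trans ((d v).+1 * m)).
  by rewrite mulSn addnC ltn_add2r.
by rewrite (leq_trans (leq_mul vw (leqnn m))) ?leq_addr.
Qed.

(* [backward v n w] is the entry at [w], for [d w + n = d v], of the left
   eigenvector of [B0] for the eigenvalue [weight v] normalized by 1 at [v]. *)
Fixpoint backward (v : 'I_m) (n : nat) (w : 'I_m) : F :=
  if n is n'.+1 then
    (\sum_(c | arc c w) backward v n' c) / (weight v - weight w)
  else (w == v)%:R.

Let Y : 'M[F]_m :=
  \matrix_(v, w) if (d w <= d v)%N then backward v (d v - d w) w else 0.

(** Triangular for the distance: distinct weights on the diagonal, and a 1 at [(j, k)] when [k] is a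
    neighbour of [j] one layer closer to the root. *)
Let B0 : 'M[F]_m :=
  \matrix_(j, k) ((weight j) *+ (j == k) + (arc j k)%:R).

Let backward_ge0 v n w : (d w + n = d v)%N -> 0 <= backward v n w.
Proof.
elim: n w => [|n IHn] w /= dw; first exact: ler0n.
rewrite divr_ge0 ?subr_ge0 //; last first.
  by apply/ltW/weight_lt; rewrite -dw addnS ltnS leq_addr.
by apply: sumr_ge0 => c /andP[_ /eqP dc]; apply: IHn; rewrite dc addSnnS.
Qed.

(** Following parents from [v] to the root, each sum contains a positive term and otherwise
    nonnegative ones, over a positive denominator; hence nothing cancels. *)
Let backward_root v : 0 < backward v (d v) r.
Proof.
suff H n : (n <= d v)%N -> exists2 w, (d w + n = d v)%N & 0 < backward v n w.
  have [w dw] := H _ (leqnn _); suff -> : w = r by [].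
  by apply: d0; apply/eqP; rewrite -(eqn_add2r (d v)) dw.
elim: n => [|n IHn] nv; first by exists v; rewrite ?addn0 //= eqxx ltr01.
have [c dc c0] := IHn (ltnW nv).
case dcE : (d c) => [|k]; first by rewrite -dc dcE ltnn in nv.
have [w ewc dw] := d_parent dcE.
exists w; first by rewrite dw addnS -addSn -dcE.
rewrite /= divr_gt0 //; last first.
  by rewrite subr_gt0 weight_lt // dw -dc dcE addSn ltnS leq_addr.
rewrite (bigD1 c) /=; last by rewrite /arc ewc dcE dw eqxx.
rewrite ltr_pwDl // sumr_ge0 // => c' /andP[/andP[_ /eqP dc'] _].
by apply: backward_ge0; rewrite dc' dw -dcE.
Qed.

Let Y_B0 : Y *m B0 = diag_mx (\row_v weight v) *m Y.
Proof.
apply/matrixP => v w; rewrite mul_diag_mx !mxE.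
under eq_bigr do rewrite !mxE mulrDr.
rewrite big_split /= (bigD1 w) //= eqxx big1 ?addr0 => [|j /negPf->];
  last by rewrite mulr0.
rewrite (bigID (arc^~ w)) /= [X in _ + (_ + X)]big1 ?addr0 => [|j /negPf->];
  last by rewrite mulr0.
have -> : \sum_(c | arc c w) (if (d c <= d v)%N then backward v (d v - d c) c
    else 0) * (arc c w)%:R = (\sum_(c | arc c w)
    if (d w < d v)%N then backward v (d v - (d w).+1) c else 0).
  by apply: eq_bigr => c cw; rewrite cw mulr1; case/andP: cw => _ /eqP ->.
(* Closer to the root than [v], the recursion is the eigenvector equation; farther away both sides
   vanish; in the layer of [v] the row is the basis vector at [v]. *)
case: (ltngtP (d w) (d v)) => [wv|_|wv].
- rewrite -(subnSK wv) /=; set S := \sum_(_ | _) _.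
  have vw0 : weight v - weight w != 0 by rewrite subr_eq0 gt_eqF ?weight_lt.
  by rewrite -[X in _ + X](divfK vw0) mulrBr addrC subrK mulrC.
- by rewrite mul0r big1 // addr0 mulr0.
rewrite wv subnn /= big1 // addr0 mulrC.
by case: (eqVneq w v) => [->|]; rewrite ?mulr0.
Qed.

Let det_krylov_B0 : \det (krylov B0 r) != 0.
Proof.
apply: (det_krylov_neq0 Y_B0) => [v w|v]; first by rewrite !mxE; exact: weight_inj.
by rewrite mxE d_r subn0 gt_eqF.
Qed.

(* [diag (t ^ d)] conjugates the line [B0 + t^2 N^T] through the triangular
   matrix [B0 = D + N] to the symmetric matrices [D + t (N + N^T)]. *)
Lemma rooted_witness : exists2 A : 'M[F]_m,
  A^T = A /\ (forall i j, i != j -> ~~ e i j -> A i j = 0) &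
  \det (krylov A r) != 0.
Proof.
pose N : 'M[F]_m := \matrix_(j, k) (arc j k)%:R.
have [p pE] := det_krylov_poly_on_lines r B0 N^T.
have p0 : p.[0] != 0 by rewrite -pE scale0r addr0.
(* The factor ['X] forces [t != 0], which makes [diag (t ^ d)] invertible; the other factor is
   nonzero since its value at 0 is [p.[0]]. *)
have [t] : exists t, ('X * (p \Po 'X^2)).[t] != 0.
  apply: poly_nonroot; rewrite mulf_neq0 ?polyX_eq0 //.
  by apply: contraNneq p0 => /(congr1 (horner^~ 0));
    rewrite horner_comp hornerXn expr0n horner0 => ->.
rewrite hornerM hornerX horner_comp hornerXn -pE mulf_eq0 negb_or.
case/andP => t0; set B := B0 + _ => KB.
pose A : 'M[F]_m := \matrix_(j, k) ((weight j) *+ (j == k) +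
  t * ((arc j k)%:R + (arc k j)%:R)).
pose T : 'M[F]_m := diag_mx (\row_j t ^+ d j).
exists A; first split.
- apply/matrixP => j k; rewrite !mxE [_ + (arc j k)%:R]addrC eq_sym.
  by case: eqVneq => [->|].
- move=> j k /negPf jk ejk; rewrite mxE jk mulr0n add0r /arc e_sym (negPf ejk).
  by rewrite /= addr0 mulr0.
have TB : T *m B = A *m T.
  apply/matrixP => j k; rewrite mul_diag_mx mul_mx_diag !mxE.
  rewrite mulrDr mulrDr mulrDl; rewrite mulrDr.
  rewrite -addrA; congr (_ + _).
    by case: (eqVneq j k) => [->|]; rewrite ?mulr0n ?mulr1n ?mul0r ?mulr0 // mulrC.
  rewrite [in RHS]mulrDl; congr (_ + _).
    case: (boolP (arc j k)) => [/andP[_ /eqP ->]|_]; last by rewrite !(mulr0, mul0r).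
    by rewrite !mulr1 exprS.
  case: (boolP (arc k j)) => [/andP[_ /eqP ->]|_]; last by rewrite !(mulr0, mul0r).
  by rewrite !mulr1 [t ^+ (d j).+1]exprS; ring.
(* [T] fixes the basis vector of [r], because [d r = 0]. *)
have -> : krylov A r = T *m krylov B r.
  apply/matrixP => j k; rewrite mul_diag_mx !mxE.
  have := congr1 (fun M : 'M_m => M j r) (mulmx_intertwineX k TB).
  rewrite mul_diag_mx mul_mx_diag !mxE d_r expr0 mulr1.
  by move=> <-.
rewrite det_mulmx mulf_neq0 // det_diag; apply/prodf_neq0 => j _.
by rewrite mxE expf_neq0.
Qed.

End LayeredWitness.

(** * Symmetric matrices with simple spectrum and nowhere zero eigenvectors *)

Lemma generic_symmetric_matrix (F : rcfType) m (e : rel 'I_m) :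
  symmetric e -> (forall i j, connect e i j) ->
  exists A : 'M[F]_m, [/\ A^T = A, forall i j, i != j -> (A i j != 0) = e i j &
    forall i, \det (krylov A i) != 0].
Proof.
move=> e_sym conn.
pose W (A : 'M[F]_m) := A^T = A /\ (forall i j, i != j -> ~~ e i j -> A i j = 0).
(* Besides the Krylov determinants, the entries on edges must not vanish; the default 1 makes the
   condition void on other pairs. *)
pose f (x : 'I_m + 'I_m * 'I_m) (A : 'M[F]_m) := match x with
  | inl i => \det (krylov A i)
  | inr (j, k) => if e j k then A j k else 1
  end.
have [||[i|[j k]]|[i|[j k]]|A [A_sym Ae] Af] := @generic_point F _ _ W f 0.
- by split=> [|i j _ _]; rewrite ?trmx0 ?mxE.
- move=> A B t [A_sym Ae] [B_sym Be]; split.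
    by rewrite linearD linearZ linearB /= A_sym B_sym.
  by move=> i j ij eij; rewrite !mxE Ae // Be // subr0 mulr0 addr0.
- exact: det_krylov_poly_on_lines.
- rewrite /f; case: (e j k); first exact: entry_poly_on_lines.
  by move=> A B; exists 1 => t; rewrite hornerC.
- have [d [d_r d0 dS]] := distance_layers (conn i).
  by have [A WA KA] := rooted_witness F e_sym d_r d0 dS; exists A.
- exists (\matrix_(i, j) (e i j)%:R); first split.
  + by apply/matrixP => x y; rewrite !mxE e_sym.
  + by move=> x y _ /negPf exy; rewrite mxE exy.
  by rewrite /f mxE; case: (e j k); rewrite oner_neq0.
exists A; split=> // [i j ij|i]; last exact: (Af (inl i)).
case: (boolP (e i j)) => [eij|eij]; last by rewrite Ae ?eqxx.
by have := Af (inr (i, j)); rewrite /f eij.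
Qed.

(** The spectral theorem is applied to the Hermitian matrix over [F[i]]. Its diagonal is real, and
    being an eigenvalue descends from [F[i]] to [F]; the basis [P] itself may remain complex. *)
Lemma symmetric_spectral (F : rcfType) n (A : 'M[F]_n) : A^T = A ->
  exists P : 'M[F[i]%C]_n, exists D : 'rV[F]_n,
    [/\ P \in unitmx,
        P *m map_mx (real_complex F) A =
          diag_mx (map_mx (real_complex F) D) *m P &
        forall j, eigenvalue A (D 0 j)].
Proof.
move=> A_sym; set AC := map_mx _ A.
have hermA : AC \is hermsymmx.
  apply: realsym_hermsym.
    by apply/is_hermitianmxP; rewrite expr0 scale1r map_mx_id // /AC map_trmx A_sym.
  by apply/mxOverP => i j; rewrite mxE; apply/complex_realP; exists (A i j).
have Preal := hermitian_spectral_diag_real hermA.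
have /hermitian_normalmx/orthomx_spectralP := hermA.
have := spectral_unit AC; set P := spectralmx AC => Pu AE.
pose D := map_mx (@complex.Re F) (spectral_diag AC).
have DE : map_mx (real_complex F) D = spectral_diag AC.
  by apply/rowP => j; rewrite !mxE RRe_real //; exact: (mxOverP Preal).
have PA : P *m AC = diag_mx (map_mx (real_complex F) D) *m P.
  by rewrite DE [in LHS]AE !mulmxA mulmxV // mul1mx.
exists P, D; split=> // j.
rewrite -(eigenvalue_map (real_complex F)); apply/eigenvalueP; exists (row j P).
  rewrite -row_mul PA; apply/rowP => k.
  by rewrite mul_diag_mx !mxE.
apply/eqP => /(congr1 (mulmx^~ (invmx P))).
rewrite rowE mulmxK // mul0mx => /rowP/(_ j); rewrite !mxE !eqxx.
by apply/eqP; exact: oner_neq0.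
Qed.

Lemma nowhere_zero_eigenbasis (F : rcfType) m (A : 'M[F]_m) :
  A^T = A -> (forall i, \det (krylov A i) != 0) ->
  exists V : 'M[F]_m, exists D : 'rV[F]_m,
    [/\ V *m V^T = 1%:M, V *m A = diag_mx D *m V, injective (D 0) &
        forall j i, V j i != 0].
Proof.
move=> A_sym KA; have [P [D [Pu PA Deig]]] := symmetric_spectral A_sym.
have DI : injective (D 0).
  move=> j k Djk; apply/eqP; apply/negPn/negP => jk.
  pose DC : 'rV[F[i]%C]_m := map_mx (real_complex F) D.
  have nz (w : 'rV_m) a : w *m diag_mx DC = a *: w -> w != 0 -> (w *m P) 0 j != 0.
    move=> wD w0; apply: (@eigenvector_entry_neq0 _ _ (map_mx (real_complex F) A) _ a).
    - by rewrite -map_krylov det_map_mx fmorph_eq0.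
    - by rewrite -mulmxA PA mulmxA wD scalemxAl.
    - by apply: contraNneq w0 => wP; rewrite -[w](mulmxK Pu) wP mul0mx.
  have Pk : P k j != 0.
    rewrite (_ : P k j = ((delta_mx 0 k : 'rV_m) *m P) 0 j); last by rewrite -rowE mxE.
    apply: (nz (delta_mx 0 k) (DC 0 k)).
      by apply/rowP => l; rewrite mul_mx_diag !mxE eqxx /=;
        case: eqVneq => [->|]; rewrite ?mulr0 ?mul0r // mulrC.
    by apply/eqP => /rowP/(_ k); rewrite !mxE !eqxx; apply/eqP; exact: oner_neq0.
  (* With a repeated eigenvalue, this combination of rows [j] and [k] of [P] is an eigenvector whose
     entry at [j] cancels. *)
  pose w : 'rV_m := P k j *: delta_mx 0 j - P j j *: delta_mx 0 k.
  have: (w *m P) 0 j != 0.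
    apply: (nz _ (DC 0 j)).
      apply/rowP => l; rewrite mul_mx_diag !mxE eqxx /=.
      case: (eqVneq l j) => [->|_]; first exact: mulrC.
      by case: (eqVneq l k) => [->|_]; rewrite ?Djk 1?mulrC // !(mulr0, subr0, mul0r).
    apply/eqP => /rowP/(_ j); rewrite !mxE !eqxx (negPf jk) mulr1 mulr0 subr0.
    exact/eqP.
  rewrite mulmxBl -!scalemxAl -!rowE !mxE [P j j * _]mulrC subrr.
  by rewrite eqxx.
have {Deig} eigv j : {v : 'rV[F]_m | v *m A = D 0 j *: v /\ v != 0}.
  by apply: cid; have /eigenvalueP[v vA v0] := Deig j; exists v.
pose v j := sval (eigv j).
have vA j : v j *m A = D 0 j *: v j by rewrite /v; case: (eigv j) => ? [].
have v0 j : v j != 0 by rewrite /v; case: (eigv j) => ? [].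
have v_nz j i : v j 0 i != 0 by apply: eigenvector_entry_neq0 (KA i) (vA j) (v0 j).
pose s j := \sum_i (v j 0 i) ^+ 2.
have s0 j : 0 < s j.
  rewrite /s (bigD1 j) //= ltr_pwDl //; first by rewrite exprn_even_gt0 //= v_nz.
  by apply: sumr_ge0 => i _; rewrite sqr_ge0.
pose V : 'M[F]_m := \matrix_(j, i) ((Num.sqrt (s j))^-1 * v j 0 i).
have VA : V *m A = diag_mx D *m V.
  apply/matrixP => j i; rewrite mul_diag_mx !mxE.
  have := congr1 (fun u : 'rV_m => u 0 i) (vA j); rewrite !mxE => vAi.
  rewrite mulrCA -vAi mulr_sumr; apply: eq_bigr => k _.
  by rewrite !mxE mulrA.
exists V, D; split=> //; last first.
  by move=> j i; rewrite mxE mulf_neq0 ?v_nz // invr_neq0 // gt_eqF ?sqrtr_gt0.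
(* The Gram matrix of the rows commutes with a diagonal matrix with distinct entries, so it is
   diagonal. *)
have VV : diag_mx D *m (V *m V^T) = V *m V^T *m diag_mx D.
  rewrite mulmxA -VA -!mulmxA; congr (_ *m _).
  by rewrite -{1}A_sym -trmx_mul VA trmx_mul tr_diag_mx.
have VVC j k : D 0 j * (V *m V^T) j k = (V *m V^T) j k * D 0 k.
  have := congr1 (fun M : 'M_m => M j k) VV.
  by rewrite mul_diag_mx mul_mx_diag mxE [RHS]mxE.
apply/matrixP => j k; rewrite [RHS]mxE.
case: (eqVneq j k) => [<-|jk]; last first.
  apply/eqP; have : (D 0 j - D 0 k) * (V *m V^T) j k == 0.
    by rewrite mulrBl VVC mulrC subrr.
  by rewrite mulf_eq0 subr_eq0 (inj_eq DI) (negPf jk).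
rewrite mxE; under eq_bigr => i _ do rewrite !mxE mulrACA -expr2 -[X in _ * X]expr2.
by rewrite -mulr_sumr -/(s j) exprVn sqr_sqrtr ?mulVf // ?gt_eqF // ltW.
Qed.

(** * Affine normalization of the spectrum *)

Lemma affine_normalization (F : realFieldType) m l (x : 'I_m -> F) :
  injective x -> (0 < l)%N -> m \in [:: l; l.+1; l.+2] ->
  exists a b, [/\ a != 0, forall j, 0 <= a * x j + b <= 1 &
    #|[set j | 0 < a * x j + b < 1]| = l].
Proof.
move=> xI l0 mE.
have m0 : (0 < m)%N by move: mE; rewrite !inE => /or3P[] /eqP ->.
pose jmin := [arg min_(j < Ordinal m0) x j]%O.
pose jmax := [arg max_(j > Ordinal m0) x j]%O.
have xmin j : x jmin <= x j.
  by rewrite /jmin; case: Order.TotalTheory.arg_minP => // i _; apply.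
have xmax j : x j <= x jmax.
  by rewrite /jmax; case: Order.TotalTheory.arg_maxP => // i _; apply.
(* [p] (resp. [q]) tells whether a margin of 1 is left below the minimum (resp. above the maximum)
   before rescaling to [[0, 1]]; without it, that extremum is sent to 0 (resp. 1). *)
have key (p q : bool) : 0 < x jmax - x jmin + p%:R + q%:R ->
    #|[set j | (p || (j != jmin)) && (q || (j != jmax))]| = l ->
    exists a b, [/\ a != 0, forall j, 0 <= a * x j + b <= 1 &
      #|[set j | 0 < a * x j + b < 1]| = l].
  set D := _ + q%:R => D0 cardJ; exists D^-1, ((p%:R - x jmin) / D).
  have E j : D^-1 * x j + (p%:R - x jmin) / D = (x j - x jmin + p%:R) / D.
    by rewrite mulrC -mulrDl; congr (_ / _); ring.
  have p0 : 0 <= p%:R :> F by []; have q0 : 0 <= q%:R :> F by [].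
  split; first by rewrite invr_eq0 gt_eqF.
    move=> j; rewrite E divr_ge0 ?ler_pdivrMr ?(ltW D0) //=.
      by rewrite mul1r /D; have := xmax j; lra.
    by have := xmin j; lra.
  rewrite -[RHS]cardJ; apply: eq_card => j; rewrite !inE E.
  rewrite pmulr_lgt0 ?invr_gt0 // ltr_pdivrMr // mul1r; congr (_ && _).
    case: (p) => /=; first by have := xmin j; lra.
    by rewrite addr0 subr_gt0 lt_neqAle xmin andbT (inj_eq xI) eq_sym.
  rewrite /D; case: (q) => /=; first by have := xmax j; lra.
  by rewrite addr0 ltrD2r ltrD2r lt_neqAle xmax andbT (inj_eq xI).
have xmM := xmin jmax.
move: mE; rewrite !inE => /or3P[] /eqP mE.
- apply: (key true true); first by rewrite /=; lra.
  by rewrite (_ : [set _ | _] = [set: 'I_m]) ?cardsT ?card_ord //.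
- apply: (key false true); first by rewrite /=; lra.
  rewrite (_ : [set _ | _] = [set~ jmin]) ?cardsC1 ?card_ord ?mE //.
  by apply/setP => j; rewrite !inE andbT.
have minmax : jmin != jmax.
  apply/eqP => jE; have xc j : x j = x jmin.
    by apply/eqP; rewrite eq_le xmin jE xmax.
  have m1 : (1 < m)%N by rewrite mE.
  by have /xI [] := etrans (xc (Ordinal m0)) (esym (xc (Ordinal m1))).
apply: (key false false).
  by rewrite /= !addr0 subr_gt0 lt_neqAle xmin (inj_eq xI) minmax.
rewrite (_ : [set _ | _] = ~: [set jmin; jmax]).
  by rewrite cardsCs finset.setCK cards2 minmax card_ord mE subn2.
by apply/setP => j; rewrite !inE negb_or.
Qed.

(** * Bounds on the number of distinct eigenvalues *)

(** A diagonalizable matrix with a single eigenvalue is scalar, hence zero at the edge [xy]. *)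
Lemma num_eigenvalues_ge2 (R : realType) (G : sgraph) (A : 'M[R]_#|G|) (x y : G) :
  sedge x y -> Smx A -> (2 <= num_eigenvalues A)%N.
Proof.
move=> xy [A_sym Ae].
have [P [D [Pu PA Deig]]] := symmetric_spectral A_sym.
have [j [k Djk]] : exists j k, D 0 j != D 0 k.
  apply: contrapT => /forallNP Dconst.
  have DE j k : D 0 j = D 0 k.
    by apply/eqP; apply: contrapT => /negP jk; apply: (Dconst j); exists k.
  have x_neq_y : enum_rank x != enum_rank y.
    by rewrite (inj_eq enum_rank_inj); apply: contraTneq xy => ->; rewrite sedge_irr.
  pose c := D 0 (enum_rank x).
  have /matrixP/(_ (enum_rank x) (enum_rank y)) :
      map_mx (real_complex R) A = (real_complex R c)%:M.
    rewrite -[LHS](mulKmx Pu) PA (_ : diag_mx _ = (real_complex R c)%:M).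
      by rewrite -scalar_mxC mulKmx.
    by apply/matrixP => i i'; rewrite !mxE (DE i (enum_rank x)).
  rewrite !mxE (negPf x_neq_y) mulr0n => /complexI; apply/eqP.
  by rewrite Ae // !enum_rankK.
apply: (@leq_trans #|` [fset D 0 j; D 0 k]%fset|); first by rewrite cardfs2 Djk.
apply/fsubset_leq_card/fsubsetP => a.
rewrite in_fset_set; last exact: finite_spectrum.
by rewrite !inE => /orP[] /eqP ->; exact: Deig.
Qed.

Lemma num_eigenvalues_idempotent (R : realType) n (A : 'M[R]_n) :
  A *m A = A -> (num_eigenvalues A <= 2)%N.
Proof.
move=> AA; apply: (@leq_trans #|` [fset 0; 1 : R]%fset|); last first.
  by rewrite cardfs2; case: (_ != _).
apply/fsubset_leq_card/fsubsetP => a.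
rewrite in_fset_set; last exact: finite_spectrum.
rewrite !inE => /eigenvalueP[v vA v0].
have : (a * (a - 1)) *: v == 0.
  by rewrite mulrBr mulr1 scalerBl -scalerA -vA scalemxAl -vA -mulmxA AA subrr.
by rewrite scaler_eq0 (negPf v0) orbF mulf_eq0 subr_eq0.
Qed.

(** The projection is given as a function on vertices, so that later computations avoid the ordinal
    indexing of [Smx]. *)
Lemma q_eq2 (R : realType) (G : sgraph) (f : G -> G -> R) (x y : G) :
  sedge x y -> (forall u v, f u v = f v u) ->
  (forall u v, u != v -> (f u v != 0) = sedge u v) ->
  (forall u v, \sum_w f u w * f w v = f u v) ->
  q R G = 2.
Proof.
move=> xy f_sym f_edge f_idem.
pose A : 'M[R]_#|G| := \matrix_(i, j) f (enum_val i) (enum_val j).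
have SA : Smx A.
  split; first by apply/matrixP => i j; rewrite !mxE f_sym.
  by move=> i j ij; rewrite mxE f_edge // (inj_eq enum_val_inj).
have AA : A *m A = A.
  apply/matrixP => i j; rewrite !mxE -[RHS]f_idem [RHS]big_enum_val /=.
  by apply: eq_bigr => k _; rewrite !mxE.
rewrite /q; case: ex_minnP => k /asboolP[B SB <-] kmin.
apply/eqP; rewrite eqn_leq (num_eigenvalues_ge2 xy SB) andbT.
apply: leq_trans (num_eigenvalues_idempotent AA); apply: kmin.
by apply/asboolP; exists A.
Qed.

(** * The projection for the join *)

Lemma sum_tag (V : nmodType) (I : finType) (n : I -> nat) (F : I -> V) :
  \sum_(s : {c : I & 'I_(n c)}) F (tag s) = \sum_c F c *+ n c.
Proof.
rewrite -(@sig_big_dep _ _ _ I (fun c => 'I_(n c)) xpredT (fun _ => xpredT)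
  (fun c _ => F c)).
by apply: eq_bigr => c _; rewrite sumr_const card_ord.
Qed.

Lemma connected_normalized_spectrum (F : rcfType) l (G : sgraph) :
  (0 < l)%N -> connected G -> #|G| \in [:: l; l.+1; l.+2] ->
  exists (V : 'M[F]_#|G|) (mu : 'rV[F]_#|G|) (f : 'I_l -> 'I_#|G|),
    [/\ V *m V^T = 1%:M, forall j i, V j i != 0,
        forall i j, i != j -> ((V^T *m diag_mx mu *m V) i j != 0) =
          sedge (enum_val i) (enum_val j),
        injective f /\ (forall c, 0 < mu 0 (f c) < 1) &
        forall j, j \notin codom f -> mu 0 j = 0 \/ mu 0 j = 1].
Proof.
move=> l0 connG cardG.
pose e (i j : 'I_#|G|) := sedge (enum_val i) (enum_val j).
have e_sym : symmetric e by move=> i j; exact: sedge_sym.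
have e_conn i j : connect e i j.
  have /connectP[p pG pj] := connG (enum_val i) (enum_val j).
  apply/connectP; exists (map enum_rank p); last first.
    by rewrite -(enum_valK i) last_map -pj enum_valK.
  rewrite -(enum_valK i) path_map; apply: sub_path pG => x y.
  by rewrite /e /= !enum_rankK.
have [A [A_sym Ae KA]] := generic_symmetric_matrix F e_sym e_conn.
have [V [D [VVT VA DI V0]]] := nowhere_zero_eigenbasis A_sym KA.
have [a [b [a0 mu01 cardJ]]] := affine_normalization DI l0 cardG.
pose mu : 'rV[F]_#|G| := \row_j (a * D 0 j + b).
pose f (c : 'I_l) : 'I_#|G| := enum_val (cast_ord (esym cardJ) c).
exists V, mu, f; split=> //.
- move=> i j ij; rewrite -/(e i j) -Ae //.
  (* [V^T diag(mu) V] is thus [a A + b I], with the same off-diagonal pattern as [A]. *)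
  have -> : diag_mx mu = a *: diag_mx D + b%:M.
    apply/matrixP => x y; rewrite !mxE.
    by case: eqVneq; rewrite ?mulr1n // mulr0n mulr0 addr0.
  rewrite mulmxDr mulmxDl -scalemxAr -scalemxAl -(mulmxA V^T (diag_mx D)) -VA.
  rewrite mulmxA (mulmx1C VVT) mul1mx mul_mx_scalar -scalemxAl (mulmx1C VVT) !mxE (negPf ij).
  by rewrite mulr0 addr0 mulf_eq0 (negPf a0).
- split=> [c c' /enum_val_inj/cast_ord_inj //|c]; rewrite mxE.
  by have := enum_valP (cast_ord (esym cardJ) c); rewrite inE.
- move=> j; rewrite mxE => jf; have /andP[mu0 mu1] := mu01 j.
  case: (boolP (0 < a * D 0 j + b < 1)) => [muj|].
    have jJ : j \in [set j | 0 < a * D 0 j + b < 1] by rewrite inE.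
    case/codomP: jf; exists (cast_ord cardJ (enum_rank_in jJ j)).
    by rewrite /f cast_ordK enum_rankK_in.
  rewrite negb_and -!leNgt => /orP[] muj; [left | right]; apply/eqP.
    by rewrite eq_le muj.
  by rewrite eq_le muj andbT.
Qed.

Lemma q_join_cliques (R : realType) l (G : sgraph) (n : 'I_l -> nat)
    (V : 'M[R]_#|G|) (mu : 'rV[R]_#|G|) (f : 'I_l -> 'I_#|G|) :
  (0 < l)%N -> (forall c, (0 < n c)%N) ->
  V *m V^T = 1%:M -> (forall j i, V j i != 0) ->
  (forall i j, i != j -> ((V^T *m diag_mx mu *m V) i j != 0) =
    sedge (enum_val i) (enum_val j)) ->
  injective f -> (forall c, 0 < mu 0 (f c) < 1) ->
  (forall j, j \notin codom f -> mu 0 j = 0 \/ mu 0 j = 1) ->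
  q R (join G (disjoint_union (fun c => complete (n c)))) = 2%N.
Proof.
move=> l0 n0 VVT V0 M_edge f_inj fJ muN; set H := disjoint_union _.
have mu01 j : 0 <= mu 0 j <= 1.
  have [/codomP[c ->]|/muN[] ->] := boolP (j \in codom f); last 2 first.
  - by rewrite lexx ler01.
  - by rewrite lexx ler01.
  by have /andP[/ltW -> /ltW ->] := fJ c.
(* The [n c] equal rows of clique [c] add [1 - mu] to the squared norm [mu] of column [f c],
   completing it to 1. *)
pose g j c : R := Num.sqrt ((1 - mu 0 j) / (n c)%:R) *+ (j == f c).
pose U (u : (G + {c : 'I_l & 'I_(n c)})%type) (j : 'I_#|G|) : R := match u with
  | inl x => Num.sqrt (mu 0 j) * V j (enum_rank x)
  | inr s => g j (tag s)
  end.
(* The diagonal of the Gram matrix [U^T U]; outside [codom f], [mu] is already 0 or 1. *)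
pose E j := if j \in codom f then 1 else mu 0 j.
have UU j k : \sum_u U u j * U u k = E j *+ (j == k).
  rewrite big_sumType /=.
  rewrite (_ : \sum_(x : G) _ = mu 0 j *+ (j == k)); last first.
    have /matrixP/(_ j k) := VVT; rewrite !mxE => VVjk.
    rewrite (eq_bigr (fun x => Num.sqrt (mu 0 j) * Num.sqrt (mu 0 k) *
      (V j (enum_rank x) * V^T (enum_rank x) k))); last first.
      by move=> x _; rewrite mxE mulrACA.
    rewrite -mulr_sumr (reindex (@enum_val _ G)) /=; last first.
      exact/onW_bij/enum_val_bij.
    under eq_bigr do rewrite enum_valK.
    rewrite VVjk; case: eqVneq => [<-|_]; last by rewrite mulr0.
    by rewrite mulr1 -expr2 sqr_sqrtr //; case/andP: (mu01 j).
  rewrite (sum_tag n (fun c => g j c * g k c)).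
  rewrite /E /g; case: ifPn => [jJ|jJ]; last first.
    rewrite big1 ?addr0 // => c _.
    rewrite (_ : (j == f c) = false) ?mulr0n ?mul0r ?mul0rn //.
    by apply: contraNF jJ => /eqP ->; exact: codom_f.
  have /codomP[c jE] := jJ; rewrite (bigD1 c) //= big1 ?addr0; last first.
    move=> c' c'c; rewrite jE (inj_eq f_inj) eq_sym (negPf c'c).
    by rewrite mulr0n mul0r mul0rn.
  rewrite -jE eqxx mulr1n [k == j]eq_sym.
  case: eqVneq => [<-|_]; last by rewrite mulr0n mulr0 mul0rn addr0.
  have muj : 0 <= (1 - mu 0 j) / (n c)%:R.
    by rewrite divr_ge0 // subr_ge0; case/andP: (mu01 j).
  rewrite !mulr1n -expr2 sqr_sqrtr // -[X in _ + X]mulr_natr.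
  rewrite divfK ?subrKC //.
  by rewrite pnatr_eq0 -lt0n n0.
(* A column of [U] with [E j = 0] is zero, so [U (U^T U) = U]. *)
have UE u j : U u j * E j = U u j.
  rewrite /E; case: ifPn => [_|jJ]; first exact: mulr1.
  case: u => [x|s] /=.
    by case: (muN j jJ) => ->; rewrite ?sqrtr0 ?mul0r ?mulr1.
  rewrite /g (_ : j == f (tag s) = false) ?mulr0n ?mul0r //.
  by apply: contraNF jJ => /eqP ->; exact: codom_f.
pose P u v := \sum_j U u j * U v j.
have x0 : G := enum_val (f (Ordinal l0)).
have s0 : H by exists (Ordinal l0); exact: Ordinal (n0 _).
have Prr (s t : H) : P (inr s) (inr t) =
    ((1 - mu 0 (f (tag s))) / (n (tag s))%:R) *+ (tag s == tag t).
  rewrite /P /= /g (bigD1 (f (tag s))) //= eqxx mulr1n big1 ?addr0; last first.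
    by move=> j /negPf ->; rewrite mulr0n mul0r.
  rewrite (inj_eq f_inj); case: eqVneq => [<-|_]; last by rewrite !mulr0n mulr0.
  rewrite !mulr1n -expr2 sqr_sqrtr // divr_ge0 // subr_ge0.
  by case/andP: (mu01 (f (tag s))).
(* Only the coordinate [f (tag s)] contributes, so no cancellation can occur; this is where nowhere
   zero eigenvectors are needed. *)
have Plr (x : G) (s : H) : P (inl x) (inr s) != 0.
  rewrite /P /= /g (bigD1 (f (tag s))) //= eqxx mulr1n big1 ?addr0; last first.
    by move=> j /negPf ->; rewrite mulr0n mulr0.
  have /andP[mu0 mu1] := fJ (tag s).
  rewrite !mulf_neq0 ?V0 // gt_eqF // sqrtr_gt0 //.
  by rewrite divr_gt0 ?subr_gt0 // ltr0n n0.
have Psym u v : P u v = P v u by apply: eq_bigr => j _; exact: mulrC.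
apply: (@q_eq2 R (join G H) P (inl x0) (inr s0)) => //.
- move=> [x|s] [y|t] uv //=; last 2 first.
  + by rewrite Psym Plr.
  + rewrite Prr /= /disjoint_union_edge /=; case: s t uv => [c p] [c' p'] /=.
    case: (eqVneq c c') => [cc'|_]; last by rewrite mulr0n eqxx.
    case: _ / cc' p' => p'; rewrite tagged_asE /= /complete_edge mulr1n => pp'.
    rewrite (_ : p != p'); last by apply: contraNneq pp' => ->.
    have /andP[mu0 mu1] := fJ c.
    by rewrite gt_eqF // divr_gt0 ?subr_gt0 // ltr0n n0.
  + have xy : enum_rank x != enum_rank y.
      by rewrite (inj_eq enum_rank_inj); apply: contraNneq uv => ->.
    have := M_edge _ _ xy; rewrite !enum_rankK => <-; congr (_ != 0).
    rewrite [RHS]mxE; apply: eq_bigr => j _; rewrite mul_mx_diag !mxE.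
    rewrite mulrACA -expr2 sqr_sqrtr; last by case/andP: (mu01 j).
    by rewrite mulrA [mu 0 j * _]mulrC.
  + exact: Plr.
- move=> u v.
  (* [P^2 = U (U^T U) U^T]: summing over [w] first produces the Gram matrix. *)
  transitivity (\sum_w \sum_j \sum_k U u j * U v k * (U w j * U w k)).
    apply: eq_bigr => w _; rewrite mulr_suml; apply: eq_bigr => j _.
    by rewrite mulr_sumr; apply: eq_bigr => k _; ring.
  rewrite exchange_big; apply: eq_bigr => j _; rewrite exchange_big /=.
  under eq_bigr => k _ do rewrite -mulr_sumr UU.
  rewrite (bigD1 j) //= eqxx mulr1n big1 ?addr0 => [|k kj]; last first.
    by rewrite eq_sym (negPf kj) mulr0n mulr0.
  by rewrite mulrAC UE.
Qed.

Close Scope ring_scope.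

Theorem theorem3p3 (R : realType) (l : nat) (G : sgraph) (n : 'I_l -> nat) :
  (0 < l)%N ->
  connected G ->
  #|G| \in [:: l; l.+1; l.+2] ->
  (forall j : 'I_l, (0 < n j)%N) ->
  q R (join G (disjoint_union (fun j : 'I_l => complete (n j)))) = 2.
Proof.
move=> l0 connG cardG n0.
have [V [mu [f [VVT V0 M_edge [f_inj fJ] muN]]]] :=
  connected_normalized_spectrum R l0 connG cardG.
exact: q_join_cliques VVT V0 M_edge f_inj fJ muN.
Qed.
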